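(* Let $I$ be a non-empty set and let $E\subseteq\mathbb{R}^I$ be a linear subspace containing all $e_i$ ($i\in I$), endowed with a complete absolute normalised norm $\|\cdot\|_E$ such that $\operatorname{span}\{e_i:i\in I\}$ is dense in $E$. If $(X_i)_{i\in I}$ is a family of Banach spaces such that $\delta(\varepsilon):=\inf_{i\in I}\delta_{\mathrm{uacs}}^{X_i}(\varepsilon)>0$ for every $0<\varepsilon\le 2$, and if $E$ is uniformly smooth, then $\bigl[\bigoplus_{i\in I}X_i\bigr]_E$ is a uacs space.
   Context: Banach spaces are real; $S_X$ denotes the unit sphere of $X$ and $X^*$ its dual. A Banach space $X$ is called uacs if for all sequences $(x_n)$, $(y_n)$ in $S_X$ and $(x_n^* )$ in $S_{X^*}$: $\|x_n+y_n\|\to 2$ and $x_n^*(x_n)\to 1$ imply $x_n^*(y_n)\to 1$. $X$ is uniformly smooth if $\lim_{\tau\to 0}\rho_X(\tau)/\tau=0$, where $\rho_X(\tau)=\sup\{\tfrac12(\|x+\tau y\|+\|x-\tau y\|-2):x,y\in S_X\}$ for $\tau>0$. For $0<\varepsilon\le 2$ put $D_X(\varepsilon)=\{(x,y)\in S_X\times S_X:\exists\,x^*\in S_{X^*}\text{ with }x^*(x)=1\text{ and }x^*(y)\le 1-\varepsilon\}$ and $\delta_{\mathrm{uacs}}^X(\varepsilon)=\inf\{1-\|\tfrac{x+y}{2}\|:(x,y)\in D_X(\varepsilon)\}$ (with $\inf\emptyset=+\infty$). For a non-empty set $I$, $e_i\in\mathbb{R}^I$ denotes the characteristic function of $\{i\}$.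 A norm $\|\cdot\|_E$ on a subspace $E$ of $\mathbb{R}^I$ (with all $e_i\in E$) is absolute if whenever $(a_i)_{i\in I}\in E$, $(b_i)_{i\in I}\in\mathbb{R}^I$ and $|a_i|=|b_i|$ for all $i\in I$, then $(b_i)_{i\in I}\in E$ and $\|(a_i)_{i\in I}\|_E=\|(b_i)_{i\in I}\|_E$; it is normalised if $\|e_i\|_E=1$ for every $i\in I$. For a family $(X_i)_{i\in I}$ of Banach spaces, the absolute sum with respect to $E$ is $\bigl[\bigoplus_{i\in I}X_i\bigr]_E=\{(x_i)_{i\in I}\in\prod_{i\in I}X_i:(\|x_i\|)_{i\in I}\in E\}$ with the norm $\|(x_i)_{i\in I}\|_E=\|(\|x_i\|)_{i\in I}\|_E$; it is a Banach space. *)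

(* Defs.v *)
From HB Require Import structures.
From mathcomp Require Import all_boot all_order all_algebra.
From mathcomp Require Import all_classical all_reals all_analysis.
From mathcomp Require Import lra.

Set Implicit Arguments.
Unset Strict Implicit.
Unset Printing Implicit Defensive.

Import Order.TTheory GRing.Theory Num.Theory.
Import numFieldNormedType.Exports.

Local Open Scope classical_set_scope.
Local Open Scope ring_scope.

Definition unit_sphere (R : realType) (X : normedModType R) : set X := [set x | `|x| = 1].
Arguments unit_sphere {R} X _.

Definition dual_norm (R : realType) (X : normedModType R) (f : {linear X -> R}) : R :=
  sup [set `|f x| | x in [set x : X | `|x| <= 1]].

(* [sup] is [0] on unbounded sets, whence the explicit continuity clause; for
   a continuous [f] the set defining [dual_norm f] is bounded. *)
Definition dual_sphere (R : realType) (X : normedModType R) : set {linear X -> R} :=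
  [set f : {linear X -> R} | continuous f /\ dual_norm f = 1].
Arguments dual_sphere {R} X _.

Definition uacs (R : realType) (X : completeNormedModType R) : Prop :=
  forall (x y : nat -> X) (f : nat -> {linear X -> R}),
    (forall n, unit_sphere X (x n)) ->
    (forall n, unit_sphere X (y n)) ->
    (forall n, dual_sphere X (f n)) ->
    `|x n + y n| @[n --> \oo] --> (2 : R) ->
    f n (x n) @[n --> \oo] --> (1 : R) ->
    f n (y n) @[n --> \oo] --> (1 : R).

Definition smoothness_modulus (R : realType) (X : completeNormedModType R) (tau : R) : R :=
  sup [set 2^-1 * (`|p.1 + tau *: p.2| + `|p.1 - tau *: p.2| - 2)
      | p in unit_sphere X `*` unit_sphere X].

Definition uniformly_smooth (R : realType) (X : completeNormedModType R) : Prop :=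
  smoothness_modulus X tau / tau @[tau --> 0^'+] --> (0 : R).

Definition uacs_pairs (R : realType) (X : completeNormedModType R) (eps : R) : set (X * X) :=
  [set p | [/\ unit_sphere X p.1, unit_sphere X p.2 &
     exists2 f, dual_sphere X f & f p.1 = 1 /\ f p.2 <= 1 - eps]].
Arguments uacs_pairs {R} X _ _.

Definition delta_uacs (R : realType) (X : completeNormedModType R) (eps : R) : \bar R :=
  ereal_inf [set (1 - `|2^-1 *: (p.1 + p.2)|)%:E | p in uacs_pairs X eps].

Definition linear_span (R : realType) (V : lmodType R) (A : set V) : set V :=
  [set v | exists n (c : 'I_n -> R) (w : 'I_n -> V),
    (forall k, A (w k)) /\ v = \sum_(k < n) c k *: w k].

(* A linear subspace of [I -> R] that contains the characteristic functions
   [\1_[set i]], with an absolute normalised norm. The values of [abs_norm]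
   outside [abs_set] are irrelevant. *)
Record absNormedSpace (R : realType) (I : Type) := AbsNormedSpace {
  abs_set : set (I -> R) ;
  abs_norm : (I -> R) -> R ;
  abs_set0 : abs_set (fun=> 0) ;
  abs_setD : forall a b, abs_set a -> abs_set b ->
    abs_set (fun i => a i + b i) ;
  abs_setZ : forall (t : R) a, abs_set a -> abs_set (fun i => t * a i) ;
  abs_normD : forall a b, abs_set a -> abs_set b ->
    abs_norm (fun i => a i + b i) <= abs_norm a + abs_norm b ;
  abs_normZ : forall (t : R) a, abs_set a ->
    abs_norm (fun i => t * a i) = `|t| * abs_norm a ;
  abs_norm0_eq0 : forall a, abs_set a -> abs_norm a = 0 -> a = (fun=> 0) ;
  abs_absolute : forall a b, abs_set a -> (forall i, `|a i| = `|b i|) ->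
    abs_set b /\ abs_norm a = abs_norm b ;
  abs_set1 : forall i, abs_set \1_[set i] ;
  abs_norm1 : forall i, abs_norm \1_[set i] = 1
}.

Record abs_elt (R : realType) (I : Type) (E : absNormedSpace R I) := AbsElt {
  abs_val :> I -> R ;
  abs_valP : abs_set E abs_val
}.

Section abs_elt_normed.
Context {R : realType} {I : Type} (E : absNormedSpace R I).
Implicit Types x y z : abs_elt E.

Lemma abs_elt_inj x y : (forall i, x i = y i) -> x = y.
Proof.
case: x y => [x xP] [y yP] /= /funext xy.
by move: yP; rewrite -xy => yP; rewrite (Prop_irrelevance xP yP).
Qed.

HB.instance Definition _ := gen_eqMixin (abs_elt E).
HB.instance Definition _ := gen_choiceMixin (abs_elt E).

Definition abs_elt_zero : abs_elt E := AbsElt (abs_set0 E).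
Definition abs_elt_add x y := AbsElt (abs_setD (abs_valP x) (abs_valP y)).
Definition abs_elt_scale (t : R) x := AbsElt (abs_setZ t (abs_valP x)).
Definition abs_elt_opp x := abs_elt_scale (-1) x.

Let addA : associative abs_elt_add.
Proof. by move=> x y z; apply: abs_elt_inj => i /=; rewrite addrA. Qed.
Let addC : commutative abs_elt_add.
Proof. by move=> x y; apply: abs_elt_inj => i /=; rewrite addrC. Qed.
Let add0 : left_id abs_elt_zero abs_elt_add.
Proof. by move=> x; apply: abs_elt_inj => i /=; rewrite add0r. Qed.
Let addN : left_inverse abs_elt_zero abs_elt_opp abs_elt_add.
Proof. by move=> x; apply: abs_elt_inj => i /=; rewrite mulN1r addNr. Qed.

HB.instance Definition _ := GRing.isZmodule.Build (abs_elt E) addA addC add0 addN.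

Let scaleA s t x :
  abs_elt_scale s (abs_elt_scale t x) = abs_elt_scale (s * t) x.
Proof. by apply: abs_elt_inj => i /=; rewrite mulrA. Qed.
Let scale1 : left_id 1 abs_elt_scale.
Proof. by move=> x; apply: abs_elt_inj => i /=; rewrite mul1r. Qed.
Let scaleDr : right_distributive abs_elt_scale +%R.
Proof. by move=> t x y; apply: abs_elt_inj => i /=; rewrite mulrDr. Qed.
Let scaleDl x : {morph abs_elt_scale^~ x : s t / s + t}.
Proof. by move=> s t; apply: abs_elt_inj => i /=; rewrite mulrDl. Qed.

HB.instance Definition _ := GRing.Zmodule_isLmodule.Build R (abs_elt E)
  scaleA scale1 scaleDr scaleDl.

Let norm x : R := abs_norm E x.
Let normD x y : norm (x + y) <= norm x + norm y.
Proof. exact: abs_normD (abs_valP x) (abs_valP y). Qed.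
Let normZ t x : norm (t *: x) = `|t| * norm x.
Proof. exact: abs_normZ (abs_valP x). Qed.
Let norm0 x : norm x = 0 -> x = 0.
Proof.
move=> /(abs_norm0_eq0 (abs_valP x)) x0.
by apply: abs_elt_inj => i; rewrite x0.
Qed.

HB.instance Definition _ :=
  Lmodule_isNormed.Build R (abs_elt E) normD normZ norm0.

Lemma abs_eltE x : `|x| = abs_norm E x. Proof. by []. Qed.
Lemma abs_eltD x y i : (x + y) i = x i + y i. Proof. by []. Qed.
Lemma abs_eltZ t x i : (t *: x) i = t * x i. Proof. by []. Qed.
Lemma abs_eltN x i : (- x) i = - x i. Proof. exact: mulN1r. Qed.
Lemma abs_eltB x y i : (x - y) i = x i - y i.
Proof. by rewrite abs_eltD abs_eltN. Qed.

Definition abs_unit (i : I) : abs_elt E := AbsElt (abs_set1 E i).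

End abs_elt_normed.

Record absBanachSpace (R : realType) (I : Type) := AbsBanachSpace {
  abs_base :> absNormedSpace R I ;
  abs_complete : forall F : set_system (abs_elt abs_base),
    ProperFilter F -> cauchy F -> cvg F
}.

Definition abs_space (R : realType) (I : Type) (E : absBanachSpace R I) : Type :=
  abs_elt E.

HB.instance Definition _ (R : realType) (I : Type) (E : absBanachSpace R I) :=
  NormedModule.on (abs_space E).
HB.instance Definition _ (R : realType) (I : Type) (E : absBanachSpace R I) :=
  Uniform_isComplete.Build (abs_space E) (@abs_complete R I E).

Lemma abs_coord_le (R : realType) (I : Type) (E : absNormedSpace R I)
  (x : abs_elt E) (i : I) : `|x i| <= `|x|.
Proof.
pose b j := if `[< j = i >] then x j else - x j.
have xb j : `|x j| = `|b j| by rewrite /b; case: ifP => // _; rewrite normrN.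
have [Eb nb] := abs_absolute (abs_valP x) xb.
pose y := AbsElt Eb.
have xy : x + y = (2 * x i) *: abs_unit E i.
  apply: abs_elt_inj => j; rewrite abs_eltD abs_eltZ /= /b /indic.
  case: asboolP => [->|ji]; first by rewrite mem_set// mulr1 mulr_natl mulr2n.
  by rewrite memNset// mulr0 subrr.
have : `|x + y| <= `|x| + `|y| by exact: ler_normD.
rewrite xy normrZ !abs_eltE abs_norm1 -nb normrM.
by rewrite ger0_norm//; lra.
Qed.

Lemma abs_coord_cvg (R : realType) (I T : Type) (E : absNormedSpace R I)
    (F : set_system T) (FF : Filter F) (u : T -> abs_elt E) (x : abs_elt E)
    (i : I) :
  u @ F --> x -> u t i @[t --> F] --> (x i : R).
Proof.
move=> /cvgrPdist_le ux; apply/cvgrPdist_le => e e0.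
apply: filterS (ux e e0) => t.
by apply: le_trans; rewrite -abs_eltB; exact: abs_coord_le.
Qed.

(* An element [a] dominated coordinatewise by [b] is [\sum_n 2^-n w_n] where
   [`|w_n i| = `|b i|] for all [i]. *)
Section solidity.
Context {R : realType} {I : Type} (E : absBanachSpace R I).

Let signed (b : abs_space E) (p : I -> bool) :
  {w : abs_space E | `|w| = `|b| &
    forall i, w i = if p i then `|b i| else - `|b i|}.
Proof.
have bw i : `|b i| = `|if p i then `|b i| else - `|b i| |.
  by case: (p i); rewrite ?normrN normr_id.
have [Ew nw] := abs_absolute (abs_valP b) bw.
by exists (AbsElt Ew).
Qed.

Lemma abs_solid (b : abs_space E) (a : I -> R) :
  (forall i, `|a i| <= `|b i|) -> abs_set E a /\ abs_norm E a <= `|b|.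
Proof.
move=> ab.
pose w (x : abs_space E) := s2val (signed b (fun i => x i <= a i)).
have nw x : `|w x| = `|b| by rewrite /w; case: signed.
have wE x i : w x i = if x i <= a i then `|b i| else - `|b i|.
  by rewrite /w; case: signed.
pose S := fix S n : abs_space E :=
  if n is n'.+1 then S n' + 2^-1 ^+ n'.+1 *: w (S n') else 0.
have SS n : S n.+1 = S n + 2^-1 ^+ n.+1 *: w (S n) by [].
have h0 n : 0 <= 2^-1 ^+ n :> R by rewrite exprn_ge0// invr_ge0.
have Sa n i : `|a i - S n i| <= 2^-1 ^+ n * `|b i|.
  elim: n => [|n IH]; first by rewrite subr0 expr0 mul1r.
  rewrite SS abs_eltD abs_eltZ wE exprS.
  move: IH (h0 n); set h := _ ^+ n; move: (S n i) => t IH h1.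
  have b0 : 0 <= `|b i| by [].
  have hb : 0 <= h * `|b i| by exact: mulr_ge0.
  move: IH; rewrite !ler_norml => /andP[l1 l2].
  by case: ifPn; rewrite -?ltNge => ta; apply/andP; split; lra.
have Sn n : `|S n| <= (1 - 2^-1 ^+ n) * `|b|.
  elim: n => [|n IH]; first by rewrite normr0 expr0 subrr mul0r.
  rewrite SS (le_trans (ler_normD _ _))// normrZ nw ger0_norm// exprS.
  by move: IH; set h := _ ^+ n; lra.
have telE : series (telescope S) = S.
  by rewrite telescopeK; apply/funext => n /=; rewrite subr0.
have telS k : telescope S k = 2^-1 ^+ k.+1 *: w (S k).
  by rewrite -[LHS]/(S k.+1 - S k) SS addrC addKr.
have cS : cvgn S.
  rewrite -telE; apply: normed_cvg.
  have -> : [normed series (telescope S)] =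
      series (geometric (2^-1 * `|b|) (2^-1 : R)).
    apply/funext => n; apply: eq_bigr => k _.
    transitivity `|telescope S k|; first by [].
    rewrite telS normrZ nw ger0_norm//.
    by rewrite exprS mulrAC.
  by apply: is_cvg_geometric_series; rewrite ger0_norm ?invr_ge0//; lra.
have /cvg_ex[/= s Ss] := cS.
have sa : a = s.
  apply/funext => i.
  have Ssi : S n i @[n --> \oo] --> (s i : R) by exact: abs_coord_cvg.
  suff : S n i @[n --> \oo] --> (a i : R).
    by move=> Sai; apply: (cvg_unique _ Sai Ssi); exact: norm_hausdorff.
  apply/cvgrPdist_le => e e0.
  have : geometric `|b i| (2^-1 : R) n @[n --> \oo] --> (0 : R).
    by apply: cvg_geometric; rewrite ger0_norm ?invr_ge0//; lra.
  move=> /cvgrPdist_le /(_ e e0); apply: filterS => n /=.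
  rewrite sub0r normrN ger0_norm ?mulr_ge0// => he.
  by rewrite (le_trans (Sa n i))// mulrC.
split; first by rewrite sa; exact: abs_valP.
rewrite sa -abs_eltE.
have Ss' : `|S n| @[n --> \oo] --> (`|s| : R) by exact: cvg_norm.
rewrite -(cvg_lim _ Ss')//; apply: limr_le; first by apply/cvg_ex; exists `|s|.
apply: nearW => n; rewrite (le_trans (Sn n))//.
by rewrite ler_piMl// lerBlDr lerDl.
Qed.
End solidity.

Record abs_sum (R : realType) (I : Type) (E : absBanachSpace R I)
    (X : I -> completeNormedModType R) := AbsSum {
  sum_val :> forall i, X i ;
  sum_valP : abs_set E (fun i => `|sum_val i|)
}.

Section abs_sum_banach.
Context {R : realType} {I : Type} (E : absBanachSpace R I)
  (X : I -> completeNormedModType R).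
Implicit Types x y z : abs_sum E X.

Lemma abs_sum_inj x y : (forall i, x i = y i) -> x = y.
Proof.
case: x y => [x xP] [y yP] /= xy.
have {}xy : x = y by exact: functional_extensionality_dep.
by move: yP; rewrite -xy => yP; rewrite (Prop_irrelevance xP yP).
Qed.

HB.instance Definition _ := gen_eqMixin (abs_sum E X).
HB.instance Definition _ := gen_choiceMixin (abs_sum E X).

Definition sum_norms x : abs_space E := AbsElt (sum_valP x).

Lemma abs_sum_solid (f : forall i, X i) (b : abs_space E) :
  (forall i, `|f i| <= b i) ->
  abs_set E (fun i => `|f i|) /\ abs_norm E (fun i => `|f i|) <= `|b|.
Proof.
move=> fb; apply: abs_solid => i; rewrite normr_id.
exact: le_trans (fb i) (ler_norm _).
Qed.

Let setD x y : abs_set E (fun i => `|x i + y i|).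
Proof.
apply: (abs_sum_solid (b := sum_norms x + sum_norms y) _).1 => i.
exact: ler_normD.
Qed.
Let setZ (t : R) x : abs_set E (fun i => `|t *: x i|).
Proof.
by apply: (abs_sum_solid (b := `|t| *: sum_norms x) _).1 => i; rewrite normrZ.
Qed.
Let set0 : abs_set E (fun i => `|0 : X i|).
Proof. by apply: (abs_sum_solid (b := 0) _).1 => i; rewrite normr0. Qed.

Definition abs_sum_zero : abs_sum E X := AbsSum set0.
Definition abs_sum_add x y := AbsSum (setD x y).
Definition abs_sum_scale (t : R) x := AbsSum (setZ t x).
Definition abs_sum_opp x := abs_sum_scale (-1) x.

Let addA : associative abs_sum_add.
Proof. by move=> x y z; apply: abs_sum_inj => i /=; rewrite addrA. Qed.
Let addC : commutative abs_sum_add.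
Proof. by move=> x y; apply: abs_sum_inj => i /=; rewrite addrC. Qed.
Let add0 : left_id abs_sum_zero abs_sum_add.
Proof. by move=> x; apply: abs_sum_inj => i /=; rewrite add0r. Qed.
Let addN : left_inverse abs_sum_zero abs_sum_opp abs_sum_add.
Proof. by move=> x; apply: abs_sum_inj => i /=; rewrite scaleN1r addNr. Qed.

HB.instance Definition _ :=
  GRing.isZmodule.Build (abs_sum E X) addA addC add0 addN.

Let scaleA s t x :
  abs_sum_scale s (abs_sum_scale t x) = abs_sum_scale (s * t) x.
Proof. by apply: abs_sum_inj => i /=; rewrite scalerA. Qed.
Let scale1 : left_id 1 abs_sum_scale.
Proof. by move=> x; apply: abs_sum_inj => i /=; rewrite scale1r. Qed.
Let scaleDr : right_distributive abs_sum_scale +%R.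
Proof. by move=> t x y; apply: abs_sum_inj => i /=; rewrite scalerDr. Qed.
Let scaleDl x : {morph abs_sum_scale^~ x : s t / s + t}.
Proof. by move=> s t; apply: abs_sum_inj => i /=; rewrite scalerDl. Qed.

HB.instance Definition _ := GRing.Zmodule_isLmodule.Build R (abs_sum E X)
  scaleA scale1 scaleDr scaleDl.

Let norm x : R := abs_norm E (fun i => `|x i|).
Let normD x y : norm (x + y) <= norm x + norm y.
Proof.
rewrite (le_trans _ (ler_normD (sum_norms x) (sum_norms y)))//.
by apply: (abs_sum_solid _).2 => i; exact: ler_normD.
Qed.
Let normZ t x : norm (t *: x) = `|t| * norm x.
Proof.
rewrite -[in RHS](normr_id t) -(abs_normZ `|t| (sum_valP x)).
by congr abs_norm; apply/funext => i; rewrite -normrZ.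
Qed.
Let norm0 x : norm x = 0 -> x = 0.
Proof.
move=> /(abs_norm0_eq0 (sum_valP x)) x0; apply: abs_sum_inj => i.
by apply/normr0_eq0; rewrite (congr1 (fun f => f i) x0).
Qed.

HB.instance Definition _ :=
  Lmodule_isNormed.Build R (abs_sum E X) normD normZ norm0.

Lemma abs_sumE x : `|x| = abs_norm E (fun i => `|x i|). Proof. by []. Qed.
Lemma abs_sumD x y i : (x + y) i = x i + y i. Proof. by []. Qed.
Lemma abs_sumZ t x i : (t *: x) i = t *: x i. Proof. by []. Qed.
Lemma abs_sumN x i : (- x) i = - x i. Proof. exact: scaleN1r. Qed.
Lemma abs_sumB x y i : (x - y) i = x i - y i.
Proof. by rewrite abs_sumD abs_sumN. Qed.

Lemma sum_normsE x i : sum_norms x i = `|x i|. Proof. by []. Qed.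

Lemma sum_norms_lip x y : `|sum_norms x - sum_norms y| <= `|x - y|.
Proof.
rewrite abs_eltE; apply: (abs_solid (b := sum_norms (x - y)) _).2 => i.
by rewrite abs_eltB !sum_normsE normr_id abs_sumB; exact: ler_dist_dist.
Qed.

Lemma sum_coord_le x i : `|x i| <= `|x|.
Proof. by have := abs_coord_le (sum_norms x) i; rewrite normr_id. Qed.

Let complete (F : set_system (abs_sum E X)) :
  ProperFilter F -> cauchy F -> cvg F.
Proof.
move=> FF /cauchyP Fc.
have lipc (V : completeNormedModType R) (g : abs_sum E X -> V) :
    (forall x y, `|g x - g y| <= `|x - y|) -> cvg (g @ F).
  move=> gl; apply: cauchy_cvg; apply/cauchyP => e e0.
  have [x Fx] := Fc e e0; exists (g x).
  suff : F [set y | ball (g x) e (g y)] by [].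
  apply: filterS Fx => y; rewrite -!ball_normE /=.
  exact: le_lt_trans.
have coordc i : cvg ((fun x : abs_sum E X => x i) @ F).
  by apply: lipc => x y; rewrite -abs_sumB; exact: sum_coord_le.
pose l i : X i := lim ((fun x : abs_sum E X => x i) @ F).
(* the norms of a translate of [F] converge in [E], to the norms of [l - z] *)
have norml z : exists2 a : abs_space E, sum_norms (x - z) @[x --> F] --> a &
    forall i, a i = `|l i - z i|.
  have /cvg_ex[/= a ca] : cvg (sum_norms (x - z) @[x --> F]).
    apply: lipc => x y; apply: le_trans (sum_norms_lip _ _) _.
    by rewrite opprB addrA subrK.
  exists a => // i.
  have ai : (fun x : abs_sum E X => `|x i - z i|) @ F --> (a i : R).
    have ci : sum_norms (x - z) i @[x --> F] --> (a i : R).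
      exact: abs_coord_cvg.
    suff -> : (fun x : abs_sum E X => `|x i - z i|) =
              (fun x => sum_norms (x - z) i) by [].
    by apply/funext => x; rewrite sum_normsE abs_sumB.
  have li : (fun x : abs_sum E X => `|x i - z i|) @ F --> (`|l i - z i| : R).
    by apply: cvg_norm; apply: cvgB; [exact: coordc|exact: cvg_cst].
  by apply: (cvg_unique _ ai li); exact: norm_hausdorff.
have lE : abs_set E (fun i => `|l i|).
  have [a _ al] := norml 0.
  have -> : (fun i => `|l i|) = a by apply/funext => i; rewrite al subr0.
  exact: abs_valP.
pose L : abs_sum E X := AbsSum lE.
apply/cvg_ex; exists L; apply/cvgrPdist_lt => e e0.
have e20 : 0 < e / 2 by rewrite divr_gt0.
have [z Fz] := Fc _ e20.
have Lz : `|L - z| <= e / 2.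
  have [a ca al] := norml z.
  have -> : `|L - z| = `|a|.
    by congr abs_norm; apply/funext => i; rewrite al abs_sumB.
  have na : `|sum_norms (x - z)| @[x --> F] --> (`|a| : R) by exact: cvg_norm.
  rewrite -(cvg_lim _ na)//; apply: limr_le; first by apply/cvg_ex; exists `|a|.
  apply: filterS Fz => x; rewrite -ball_normE /= distrC => /ltW.
  exact: le_trans.
apply: filterS Fz => x; rewrite -ball_normE /= => zx.
rewrite (le_lt_trans (ler_distD z _ _))// (splitr e).
exact: ler_ltD.
Qed.

HB.instance Definition _ := Uniform_isComplete.Build (abs_sum E X) complete.

End abs_sum_banach.

(* Main.v *)
Require Import Defs.
From HB Require Import structures.
From mathcomp Require Import all_boot all_order all_algebra.
From mathcomp Require Import all_classical all_reals all_analysis.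
From mathcomp Require Import lra.

Set Implicit Arguments.
Unset Strict Implicit.
Unset Printing Implicit Defensive.

Import Order.TTheory GRing.Theory Num.Theory.
Import numFieldNormedType.Exports.

Local Open Scope classical_set_scope.
Local Open Scope ring_scope.

(** Let [Z] be the sum, [x] and [y] unit vectors of [Z] with [x + y] of norm
    nearly [2], and [f] a functional of norm [1] with [f x] nearly [1]; write
    [a], [b], [c] for the families of coordinate norms of [x], [y], [x + y],
    and [f_i] for the functional that [f] induces on [X i].

    Choosing in each [X i] a vector [w_i] of the unit ball that almost norms
    [f_i] turns [f] into a functional [l] on [E], [l p = f ((p i) w_i)_i], of
    norm at most [1]. For [L = K l], with [K] slightly above [1], one has
    [f_i v <= L e_i * |v|] for all [i] and [v]. As the span of the unit vectors
    is dense, inequalities between [f] and [L] can be checked coordinate by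
    coordinate ([domination]): this replaces the description of the dual of
    [Z].

    Uniform smoothness of [E] says that if [l] almost norms [p] and [|p + q|] is
    nearly [2], then [l q] is nearly [1] ([uniformly_smooth_norming]). It is
    used twice.
    - With [p = a] and [q = c / |c|] it gives that [L (a + b - c)] is small. As
      [L a - f x] is small too, the coordinates at which [x i], [y i] and [f_i]
      are far from the extremal situation of the definition of uacs are bad
      only in a weak sense: if [m] is the minimum of [a] and [b] on bad
      coordinates and [0] elsewhere, then [L m] is small ([bad_min_le]).
    - Bad coordinates with [b i < a i] are therefore harmless, but on the set
      [A] of those with [a i <= b i] only [a], not [b], is known to be small
      for [L]. Let [flip A] change the signs on [A]. Then [l (flip A a)]
      is still nearly [1], so smoothness applied to the functional [l o flip A],
      again of norm at most [1], yields [l (flip A b)] nearly [1]: the part of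
      [b] on [A] is small for [l].

    On the good coordinates the moduli of the [X i] are used in the form
    [|u - t v| <= 1 - t (1 - e)] for unit vectors with [2 - t <= |u + v|]
    ([uacs_uniform_descent]). This form has the advantage that any functional
    almost norming [u] inherits from it a lower bound at [v], whereas the
    definition of the moduli speaks of functionals that attain their norm at
    the first vector. Its proof takes a norming functional at [u - t v], whence
    the Hahn-Banach theorem. Summing up, [f y >= L (flip A b) - 2 e L b - 2 L m]
    ([functional_ge_of_flip]), and the right-hand side is nearly [1]. *)

(** * The Hahn-Banach theorem *)

Section hahn_banach.
Context {R : realType} {V : lmodType R}.
Implicit Types (p q : V -> R) (x y : V).

(** The inequality in the second clause is equivalent to the usual equality,
    see [sublinearZ]. *)
Definition sublinear q :=
  (forall x y, q (x + y) <= q x + q y) /\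
  (forall t x, 0 < t -> q (t *: x) <= t * q x).

Lemma sublinearZ q t x : sublinear q -> 0 < t -> q (t *: x) = t * q x.
Proof.
move=> [_ qZ] t0; apply/eqP; rewrite eq_le qZ//=.
by rewrite -ler_pdivlMl// -[in leLHS](scalerK (lt0r_neq0 t0) x) qZ ?invr_gt0.
Qed.

Lemma sublinear0 q : sublinear q -> q 0 = 0.
Proof.
move=> qs; have := @sublinearZ q 2 0 qs (ltr0n _ 2).
by rewrite scaler0 => ?; lra.
Qed.

Lemma sublinear_ge q x : sublinear q -> - q (- x) <= q x.
Proof.
by move=> qs; have := qs.1 x (- x); rewrite subrr sublinear0// => ?; lra.
Qed.

(** Subadditivity of the infimum is where directedness enters: the infima at [x]
    and at [y] are approached by two members of the family, which a third one
    bounds from below. The values stay bounded below at each point because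
    [q x >= - q (- x) >= - p (- x)]. *)
Lemma inf_directed_sublinear p (F : set (V -> R)) :
  F !=set0 ->
  (forall q, F q -> sublinear q /\ forall x, q x <= p x) ->
  (forall q r, F q -> F r ->
    exists2 s, F s & forall x, s x <= q x /\ s x <= r x) ->
  sublinear (fun x => inf [set q x | q in F]) /\
  forall q x, F q -> inf [set q x | q in F] <= q x.
Proof.
move=> [q0 Fq0] FP Fdir.
have infle q x : F q -> inf [set q x | q in F] <= q x.
  move=> Fq; apply: ge_inf; last by exists q.
  exists (- p (- x)) => _ [r Fr <-].
  have [rs rp] := FP _ Fr.
  by rewrite (le_trans _ (sublinear_ge x rs))// lerN2.
have leinf a x : (forall q, F q -> a <= q x) -> a <= inf [set q x | q in F].
  move=> aF; apply: lb_le_inf; first by exists (q0 x); exists q0.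
  by move=> _ [q Fq <-]; exact: aF.
split => //; split=> [x y|t x t0].
  rewrite -lerBlDr; apply: (leinf _ _) => q Fq.
  rewrite lerBlDr [leRHS]addrC -lerBlDr; apply: (leinf _ _) => r Fr.
  have [s Fs sqr] := Fdir _ _ Fq Fr.
  rewrite lerBlDr (le_trans (infle _ _ Fs))//.
  rewrite (le_trans ((FP _ Fs).1.1 x y))// [leLHS]addrC.
  by rewrite lerD ?(sqr _).1 ?(sqr _).2.
rewrite -ler_pdivrMl//; apply: (leinf _ _) => q Fq.
by rewrite ler_pdivrMl// (le_trans (infle _ _ Fq))// (FP _ Fq).1.2.
Qed.

(** A sublinear minorant of [q] that takes at [- y] a value at most [- q y]. It
    coincides with [q] for all [y] exactly when [q] is odd, hence linear. *)
Definition tilt q y x :=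
  inf [set q (x + t *: y) - t * q y | t in [set t | 0 < t]].

Lemma tilt_le q y t x : sublinear q -> 0 < t ->
  tilt q y x <= q (x + t *: y) - t * q y.
Proof.
move=> qs t0; apply: ge_inf; last by exists t.
exists (- q (- x)) => _ [s s0 <-].
rewrite -sublinearZ//; have := qs.1 (x + s *: y) (- x).
by rewrite addrAC subrr add0r => ?; lra.
Qed.

Lemma le_tilt q y x (a : R) :
  (forall t, 0 < t -> a <= q (x + t *: y) - t * q y) -> a <= tilt q y x.
Proof.
move=> aq; apply: lb_le_inf; last by move=> _ [t t0 <-]; exact: aq.
by eexists; exists 1 => //=.
Qed.

Lemma tilt_sublinear q y : sublinear q -> sublinear (tilt q y).
Proof.
move=> qs; split=> [x x'|t x t0].
  rewrite -lerBlDr; apply: le_tilt => t t0.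
  rewrite lerBlDr [leRHS]addrC -lerBlDr; apply: le_tilt => s s0.
  rewrite lerBlDr (le_trans (tilt_le y (x + x') qs (addr_gt0 t0 s0)))//.
  rewrite scalerDl addrACA.
  by have := qs.1 (x + t *: y) (x' + s *: y); lra.
rewrite -ler_pdivrMl//; apply: le_tilt => s s0.
rewrite ler_pdivrMl// (le_trans (tilt_le y _ qs (mulr_gt0 t0 s0)))//.
by rewrite -scalerA -scalerDr sublinearZ// mulrBr mulrA.
Qed.

Lemma tilt_le_self q y x : sublinear q -> tilt q y x <= q x.
Proof.
move=> qs; rewrite (le_trans (tilt_le y x qs ltr01))// scale1r mul1r.
by rewrite lerBlDr qs.1.
Qed.

Lemma tilt_opp q y : sublinear q -> tilt q y (- y) <= - q y.
Proof.
move=> qs; rewrite (le_trans (tilt_le y _ qs ltr01))// scale1r mul1r addNr.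
by rewrite sublinear0// sub0r.
Qed.

(** Zorn's lemma among the sublinear minorants of [p], for the reverse order; a
    chain is directed downwards, so its infimum is again one of them. *)
Lemma minimal_sublinear p : sublinear p ->
  exists q, [/\ sublinear q, forall x, q x <= p x &
    forall r, sublinear r -> (forall x, r x <= q x) -> r = q].
Proof.
move=> ps.
pose T := {q : V -> R | sublinear q /\ forall x, q x <= p x}.
pose below (q r : T) := `[< forall x, sval r x <= sval q x >].
have [||||[q [qs qp]] qmin] := @Zorn T below.
- by move=> q; apply/asboolP => x.
- move=> q r s /asboolP qr /asboolP rs; apply/asboolP => x.
  exact: le_trans (rs x) (qr x).
- move=> q r /asboolP qr /asboolP rq; apply: eq_sig_hprop => [? ? ?|/=].
    exact: Prop_irrelevance.
  by apply/funext => x; apply/le_anti; rewrite qr rq.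
- move=> A Achain; have [[q0 Aq0]|A0] := pselect (A !=set0); last first.
    by exists (@exist _ _ p (conj ps (fun=> lexx _))) => q Aq; case: A0; exists q.
  pose F := [set sval q | q in A].
  have [||| infs infle] := @inf_directed_sublinear p F.
  + by exists (sval q0); exists q0.
  + by move=> _ [[q qP] _ <-].
  + move=> _ _ [q Aq <-] [r Ar <-].
    have [/asboolP qr|/asboolP rq] := Achain _ _ Aq Ar.
      by exists (sval r); [exists r|move=> x; rewrite qr].
    by exists (sval q); [exists q|move=> x; rewrite rq].
  have infp x : inf [set q x | q in F] <= p x.
    by rewrite (le_trans (infle (sval q0) x _)) ?(svalP q0).2//; exists q0.
  exists (@exist _ _ (fun x => inf [set q x | q in F]) (conj infs infp) : T).
  move=> q Aq; apply/asboolP => x /=.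
  by apply: infle; exists q.
exists q; split=> // r rs rq.
have rp x : r x <= p x := le_trans (rq x) (qp x).
by have /(congr1 sval) := qmin (@exist _ _ r (conj rs rp)) (asboolT rq).
Qed.

(** A sublinear function [q] that is minimal is equal to all its tilts, and is
    therefore odd and linear. Starting from [tilt p x] instead of [p] forces
    the value [p x] at [x]. *)
Lemma hahn_banach p x : sublinear p ->
  exists2 f : {linear V -> R}, (forall v, f v <= p v) & f x = p x.
Proof.
move=> ps.
have [q [qs qp qmin]] := minimal_sublinear (tilt_sublinear x ps).
have qN y : q (- y) = - q y.
  have tq : tilt q y = q.
    by apply: qmin => [|z]; [exact: tilt_sublinear|exact: tilt_le_self].
  apply/le_anti; rewrite -[leLHS]/(q (- y)) -{1}tq tilt_opp//=.
  by have := sublinear_ge y qs; rewrite lerNl.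
have qD y z : q (y + z) = q y + q z.
  apply/le_anti; rewrite qs.1/=.
  by have := qs.1 (- y) (- z); rewrite -opprD !qN; lra.
have qZ t y : q (t *: y) = t * q y.
  have [t0|t0|<-] := ltrgtP 0 t.
  - exact: sublinearZ.
  - by rewrite -[t]opprK scaleNr qN sublinearZ ?oppr_gt0// !mulNr.
  - by rewrite scale0r mul0r sublinear0.
have qL : linear_for *%R q by move=> t y z; rewrite qD qZ.
pose qlin : {linear V -> R} := HB.pack q (GRing.isLinear.Build R V R *%R q qL).
exists qlin => [v|]; first exact: le_trans (qp v) (tilt_le_self _ _ ps).
apply/le_anti; rewrite (le_trans (qp x)) ?tilt_le_self//=.
by rewrite -lerN2 -qN (le_trans (qp _))// tilt_opp.
Qed.

End hahn_banach.

(** * Norming functionals and almost norming vectors *)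

Section functionals.
Context {R : realType} {V : normedModType R}.
Implicit Types f : {linear V -> R}.

Lemma dual_sphere_le f v : dual_sphere V f -> f v <= `|v|.
Proof.
move=> [fc f1].
have /linear_boundedP /pinfty_ex_gt0 [M M0 fM] :=
  (linear_bounded_continuous f).2 fc.
have [->|v0] := eqVneq v 0; first by rewrite linear0 normr0.
have nv0 : 0 < `|v| by rewrite normr_gt0.
suff : `|f (`|v|^-1 *: v)| <= 1.
  rewrite linearZ/= normrM ger0_norm ?invr_ge0// ler_pdivrMl// mulr1.
  by apply: le_trans; exact: ler_norm.
rewrite -f1; apply: ub_le_sup.
  exists M => _ [u /= u1 <-].
  by rewrite (le_trans (fM u))// ler_piMr// ltW.
exists (`|v|^-1 *: v) => //=.
by rewrite normrZ ger0_norm ?invr_ge0// mulVf ?gt_eqF.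
Qed.

(** Hahn-Banach for the norm, which is sublinear. *)
Lemma norming_functional (z : V) : `|z| = 1 ->
  exists2 g, dual_sphere V g & g z = 1.
Proof.
move=> z1.
have ns : sublinear (fun v : V => `|v|).
  by split=> [x y|t x t0]; rewrite ?ler_normD// normrZ gtr0_norm.
have [g gle gz] := hahn_banach z ns.
have gn v : `|g v| <= `|v|.
  rewrite ler_norml gle andbT.
  by have := gle (- v); rewrite linearN/= normrN lerNl.
exists g; last by rewrite gz.
split.
  apply: bounded_linear_continuous; apply/bounded_funP => r.
  by exists r => x; apply: le_trans.
apply/le_anti/andP; split.
  apply: ge_sup; first by exists `|g z|, z; rewrite //= z1.
  by move=> _ [u /= u1 <-]; exact: le_trans (gn u) u1.
rewrite -[leLHS]z1 -[leLHS]gz -[leLHS]ger0_norm ?gz//.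
rewrite -gz; apply: ub_le_sup; last by exists z; rewrite //= z1.
by exists 1 => _ [u /= u1 <-]; exact: le_trans (gn u) u1.
Qed.

(** [K * f w] plays the role of the norm of [f]. Writing this upper bound with a
    value of [f] makes it linear in [f], and so allows the norms of all the
    coordinate functionals to be gathered into one functional on [E]. *)
Lemma almost_norming_vector f (K : R) : (forall v, f v <= `|v|) -> 1 < K ->
  exists2 w, `|w| <= 1 & forall v, f v <= K * f w * `|v|.
Proof.
move=> fle K1.
have [[v0 fv0]|f0] := pselect (exists v, 0 < f v); last first.
  exists 0; first by rewrite normr0.
  move=> v; rewrite linear0 mulr0 mul0r leNgt; apply/negP => fv.
  by apply: f0; exists v.
pose B := [set f v | v in [set v : V | `|v| <= 1]].
have Bub : has_ubound B.
  by exists 1 => _ [v /= v1 <-]; exact: le_trans (fle v) v1.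
have fB v : f v <= sup B * `|v|.
  have [->|vn0] := eqVneq v 0; first by rewrite linear0 normr0 mulr0.
  have nv0 : 0 < `|v| by rewrite normr_gt0.
  rewrite -ler_pdivrMr// mulrC.
  have -> : `|v|^-1 * f v = f (`|v|^-1 *: v) by rewrite linearZ.
  apply: ub_le_sup => //; exists (`|v|^-1 *: v) => //=.
  by rewrite normrZ ger0_norm ?invr_ge0// mulVf ?gt_eqF.
have nv0 : 0 < `|v0| := lt_le_trans fv0 (fle v0).
have B0 : 0 < sup B.
  by have := lt_le_trans fv0 (fB v0); rewrite pmulr_lgt0.
have Bsup : has_sup B by split=> //; exists (f 0), 0; rewrite //= normr0.
have gap : 0 < sup B - sup B / K.
  by rewrite subr_gt0 ltr_pdivrMr ?ltr_pMr// (lt_trans ltr01).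
have [_ [w /= w1 <-] fw] := sup_adherent gap Bsup.
exists w => // v; rewrite (le_trans (fB v))// ler_wpM2r//.
move: fw; rewrite opprB addrCA subrr addr0 ltr_pdivrMr ?(lt_trans ltr01)//.
by rewrite mulrC => /ltW.
Qed.

End functionals.

(** * Uniform consequences of the two moduli *)

Section moduli.
Context {R : realType}.

(** A functional [g] norming [z = u - t v] norms a unit vector within [2 t] of
    [u], whose sum with [v] has norm at least [2 - 3 t]. When [3 t] is below
    twice the modulus, this forces [g v > 1 - e], and so
    [|z| = g u - t * g v <= 1 - t (1 - e)]. *)
Lemma uacs_uniform_descent (I : Type) (X : I -> completeNormedModType R) (e : R) :
  0 < e <= 1 ->
  (0 < ereal_inf [set delta_uacs (X i) e | i in [set: I]])%E ->
  exists2 t : R, 0 < t & forall i (u v : X i), `|u| = 1 -> `|v| = 1 ->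
    2 - t <= `|u + v| -> `|u - t *: v| <= 1 - t * (1 - e).
Proof.
move=> /andP[e0 e1] dpos.
have [d d01 dle] : exists2 d : R, 0 < d < 1 &
    forall i p, uacs_pairs (X i) e p -> d < 1 - `|2^-1 *: (p.1 + p.2)|.
  pose D := ereal_inf [set delta_uacs (X i) e | i in [set: I]].
  have [d /andP[d0 d1] dD] : exists2 d : R, 0 < d < 1 & (d%:E < D)%E.
    have := dpos; rewrite -/D; case: D => [r| |]//.
      rewrite lte_fin => r0; exists (Num.min (r / 2) (2^-1)).
        rewrite lt_min gt_min; apply/andP; split.
          by rewrite divr_gt0//= invr_gt0.
        by apply/orP; right; rewrite invf_lt1// ltr1n.
      by rewrite lte_fin gt_min; apply/orP; left; lra.
    move=> _; exists 2^-1; last by rewrite ltry.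
    by rewrite invr_gt0 ltr0n/= invf_lt1// ltr1n.
  exists d => [|i p pp]; first by rewrite d0.
  rewrite -lte_fin (lt_le_trans dD)// (@le_trans _ _ (delta_uacs (X i) e))//.
    by apply: ereal_inf_lbound; exists i.
  by apply: ereal_inf_lbound; exists p.
case/andP: d01 => d0 d1.
(* [3 t / 2 < d] is needed at the end; [t < 1 / 2] also keeps [z] nonzero *)
exists (d / 2); first by rewrite divr_gt0.
set t := d / 2; have t0 : 0 < t by rewrite divr_gt0.
have t1 : t < 2^-1 by rewrite /t; lra.
have dt : d = 2 * t by rewrite /t; lra.
move=> i u v u1 v1 uv.
pose z := u - t *: v; pose r := `|z|; pose zh := r^-1 *: z.
have ntv : `|t *: v| = t by rewrite normrZ v1 mulr1 gtr0_norm.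
have rlo : 1 - t <= r.
  by rewrite -u1 -ntv /r /z; exact: lerB_dist.
have rhi : r <= 1 + t.
  by rewrite /r /z (le_trans (ler_normB _ _))// u1 ntv.
have r0 : 0 < r by lra.
have zh1 : `|zh| = 1 by rewrite normrZ ger0_norm ?invr_ge0 ?ltW// mulVf ?gt_eqF.
have [g gS gz] := norming_functional zh1.
have gzr : g z = r.
  move: gz; rewrite /zh linearZ/= => /(congr1 ( *%R r)).
  by rewrite mulVKf ?gt_eqF// mulr1.
rewrite -/z -/r -gzr /z linearB linearZ/= lerB//.
  by rewrite -u1; exact: dual_sphere_le.
rewrite ler_pM2l// leNgt; apply/negP => gv.
have := dle i (zh, v) (And3 zh1 v1 (ex_intro2 _ _ g gS (conj gz (ltW gv)))).
rewrite /= normrZ gtr0_norm ?invr_gt0// dt.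
have zhu : `|zh - u| <= 2 * t.
  have -> : zh - u = (zh - z) + (z - u) by rewrite addrA subrK.
  rewrite (le_trans (ler_normD _ _))//.
  have -> : z - u = - (t *: v) by rewrite /z addrAC subrr add0r.
  have -> : zh - z = (1 - r) *: zh.
    by rewrite scalerBl scale1r /zh scalerA mulfV ?gt_eqF// scale1r.
  rewrite normrN ntv normrZ zh1 mulr1.
  suff : `|1 - r| <= t by lra.
  by rewrite ler_norml; apply/andP; split; lra.
have : `|u + v| <= `|zh + v| + `|zh - u|.
  have -> : u + v = (zh + v) - (zh - u) by rewrite opprB [RHS]addrC addrA subrK.
  exact: ler_normB.
by lra.
Qed.

Lemma uniformly_smooth_descent (V : completeNormedModType R) (e : R) :
  uniformly_smooth V -> 0 < e ->
  exists2 t : R, 0 < t < 1 & forall p q : V, `|p| = 1 -> `|q| = 1 ->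
    `|p + t *: q| + `|p - t *: q| <= 2 + e * t.
Proof.
move=> /cvgrPdist_le smooth e0.
have [t [t0 t1 ht]] : exists t : R,
    [/\ 0 < t, t < 1 & `|0 - smoothness_modulus V t / t| <= e / 2].
  near (0 : R)^'+ => t; exists t; split => //.
  by near: t; apply: smooth; rewrite divr_gt0.
exists t; first exact/andP.
move=> p q p1 q1.
move: ht; rewrite sub0r normrN => /(le_trans (ler_norm _)).
rewrite ler_pdivrMr// => ht.
have : 2^-1 * (`|p + t *: q| + `|p - t *: q| - 2) <= smoothness_modulus V t.
  apply: ub_le_sup; last by exists (p, q).
  exists t => _ [[a b] /= [a1 b1] <-].
  have tb : `|t *: b| = t by rewrite normrZ b1 mulr1 gtr0_norm.
  have := ler_normD a (t *: b); have := ler_normB a (t *: b).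
  by rewrite a1 tb; lra.
by lra.
Unshelve. all: by end_near. Qed.

(** Here [|p - t q| >= l p - t * l q], where [l p] is nearly [1], and
    [|p + t q| >= |p + q| - (1 - t)] is nearly [1 + t]. The sum of the two norms
    is at most [2 + (e / 2) t] by smoothness, which leaves room only for
    [l q >= 1 - e]. *)
Lemma uniformly_smooth_norming (V : completeNormedModType R) (e : R) :
  uniformly_smooth V -> 0 < e ->
  exists2 h : R, 0 < h & forall (l : {linear V -> R}) (p q : V),
    (forall v, l v <= `|v|) -> `|p| = 1 -> `|q| = 1 ->
    1 - h <= l p -> 2 - h <= `|p + q| -> 1 - e <= l q.
Proof.
move=> smooth e0.
have e20 : 0 < e / 2 by rewrite divr_gt0.
have [t /andP[t0 t1] ht] := uniformly_smooth_descent smooth e20.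
exists (e / 4 * t); first by rewrite mulr_gt0// divr_gt0.
move=> l p q lle p1 q1 lp pq.
have := ht p q p1 q1; have := lle (p - t *: q).
rewrite linearB linearZ/= -[t *: l q]/(t * l q) => lpq.
have : `|p + q| <= `|p + t *: q| + (1 - t).
  rewrite -[X in `|X| <= _](_ : (p + t *: q) + (1 - t) *: q = _).
    rewrite (le_trans (ler_normD _ _))// lerD2l normrZ q1 mulr1.
    by rewrite ger0_norm// subr_ge0 ltW.
  by rewrite -addrA -scalerDl (addrC t) subrK scale1r.
rewrite -(ler_pM2l t0 (1 - e)).
by move: lp pq lpq; lra.
Qed.

End moduli.

(** * The uacs condition at vectors of arbitrary norm *)

Section normalisation.
Context {R : realType} {V : normedModType R}.
Implicit Types u v : V.

Lemma norm_normalised v : v != 0 -> `| `|v|^-1 *: v| = 1.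
Proof. by move=> v0; rewrite normrZ normfV normr_id mulVf ?normr_eq0. Qed.

(** Scaling the longer vector down to the length of the shorter one costs at most
    the difference of the two norms. *)
Lemma normalised_sum_ge u v (d : R) : u != 0 -> v != 0 ->
  `|u| + `|v| - `|u + v| <= d * Num.min `|u| `|v| ->
  2 - d <= `| `|u|^-1 *: u + `|v|^-1 *: v|.
Proof.
wlog uv : u v / `|u| <= `|v|.
  move=> H u0 v0; have /orP[uv|vu] := le_total `|u| `|v|; first exact: H.
  by rewrite (addrC `|u|) (addrC u) (addrC (_ *: u)) minC; exact: H.
move=> u0 v0; rewrite (min_idPl uv) => uvd.
have nu : 0 < `|u| by rewrite normr_gt0.
have nv : 0 < `|v| by rewrite normr_gt0.
set s := _ + _ *: v.
have : `|u + v| <= `|u| * `|s| + (`|v| - `|u|).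
  have -> : u + v = `|u| *: s + (1 - `|u| / `|v|) *: v.
    rewrite /s scalerDr !scalerA mulfV ?gt_eqF// scale1r -addrA -scalerDl.
    by rewrite (addrC (`|u| / `|v|)) subrK scale1r.
  rewrite (le_trans (ler_normD _ _))// !normrZ normr_id lerD2l.
  rewrite ger0_norm ?subr_ge0 ?ler_pdivrMr ?mul1r//.
  by rewrite mulrBl mul1r divfK ?gt_eqF.
rewrite -(ler_pM2l nu (2 - d)).
by lra.
Qed.

(** The hypothesis on the sum [lam * (|u| + |v| - |u + v|) + (lam * |u| - g u)] of
    two nonnegative defects is strict, and so excludes that [lam], [u] or [v]
    vanishes. It bounds each defect: the first one makes the descent hypothesis
    applicable to the normalised vectors, the second one says that [g] almost
    norms [u] among functionals bounded by [lam]. *)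
Lemma functional_ge_of_descent (g : {linear V -> R}) (lam t e : R) u v :
  (forall u v : V, `|u| = 1 -> `|v| = 1 ->
    2 - t <= `|u + v| -> `|u - t *: v| <= 1 - t * (1 - e)) ->
  0 < t -> 0 <= e <= 1 -> 0 <= lam ->
  (forall v, g v <= lam * `|v|) ->
  lam * (`|u| + `|v| - `|u + v|) + (lam * `|u| - g u)
    < e * t * (lam * Num.min `|u| `|v|) ->
  (1 - 2 * e) * (lam * `|v|) <= g v.
Proof.
move=> descent t0 /andP[e0 e1] lam0 gle small.
have tri : 0 <= `|u| + `|v| - `|u + v| by rewrite subr_ge0 ler_normD.
have gu : 0 <= lam * `|u| - g u by rewrite subr_ge0.
have triM : 0 <= lam * (`|u| + `|v| - `|u + v|) by exact: mulr_ge0.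
have et0 : 0 <= e * t by rewrite mulr_ge0// ltW.
have prod0 : 0 < e * t * (lam * Num.min `|u| `|v|).
  by apply: le_lt_trans small; exact: addr_ge0.
have lam0' : 0 < lam.
  rewrite lt_neqAle lam0 andbT; apply: contraTneq prod0 => <-.
  by rewrite mul0r mulr0 ltxx.
have u0 : u != 0.
  apply: contraTneq prod0 => ->.
  by rewrite normr0 (min_idPl _) ?normr_ge0// !mulr0 ltxx.
have v0 : v != 0.
  apply: contraTneq prod0 => ->.
  by rewrite normr0 (min_idPr _) ?normr_ge0// !mulr0 ltxx.
have nu : 0 < `|u| by rewrite normr_gt0.
have nv : 0 < `|v| by rewrite normr_gt0.
have uv : 2 - t <= `| `|u|^-1 *: u + `|v|^-1 *: v|.
  apply: le_trans (normalised_sum_ge (d := e * t) u0 v0 _).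
    by rewrite lerD2l lerN2 ler_piMl// ltW.
  rewrite -(ler_pM2l lam0') mulrCA; apply: ltW; apply: le_lt_trans small.
  by rewrite lerDl.
have := descent _ _ (norm_normalised u0) (norm_normalised v0) uv.
rewrite -(ler_pM2l lam0') => /(le_trans (gle _)).
have -> : g (`|u|^-1 *: u - t *: (`|v|^-1 *: v)) =
    `|u|^-1 * g u - t * (`|v|^-1 * g v) by rewrite linearB !linearZ.
have gu' : lam - e * t * lam <= `|u|^-1 * g u.
  rewrite ler_pdivlMl//.
  have minu : Num.min `|u| `|v| <= `|u| by rewrite ge_min lexx.
  by have := ler_wpM2l et0 (ler_wpM2l lam0 minu); lra.
move=> H.
have : t * ((1 - 2 * e) * lam) <= t * (`|v|^-1 * g v) by lra.
by rewrite ler_pM2l// ler_pdivlMl// mulrC mulrA.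
Qed.

End normalisation.

(** * Functionals on an absolute sum *)

Section absolute_sum.
Context {R : realType} {I : Type} (E : absBanachSpace R I)
  (X : I -> completeNormedModType R).
Local Notation Z := (abs_sum E X).

Definition solid_elt (b : abs_space E) (a : I -> R)
  (ab : forall i, `|a i| <= `|b i|) : abs_space E := AbsElt (abs_solid ab).1.

Lemma abs_space_norm_le (a b : abs_space E) :
  (forall i, `|a i| <= `|b i|) -> `|a| <= `|b|.
Proof. by move=> ab; rewrite [leLHS]abs_eltE; exact: (abs_solid ab).2. Qed.

Definition abs_spaceE := (@abs_eltD R I E, @abs_eltN R I E, @abs_eltZ R I E).

Fact flip_subproof (A : set I) (a : abs_space E) i :
  `|if `[< A i >] then - a i else a i| <= `|a i|.
Proof. by case: ifP => _; rewrite ?normrN. Qed.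

Definition flip (A : set I) a : abs_space E := solid_elt (flip_subproof A a).

Fact flip_linear A : linear (flip A).
Proof.
move=> t a b; apply: abs_elt_inj => i; rewrite abs_spaceE /=.
by case: ifP => // _; rewrite opprD mulrN.
Qed.

HB.instance Definition _ A :=
  GRing.isLinear.Build R (abs_space E) (abs_space E) *:%R (flip A)
    (flip_linear A).

Lemma norm_flip_le A a : `|flip A a| <= `|a|.
Proof. by apply: abs_space_norm_le => i; exact: flip_subproof. Qed.

(** The transport along [i = j] is over a proof of a classically decided equality,
    as [I] is an arbitrary type. *)
Definition embed_fun (i : I) (v : X i) (j : I) : X j :=
  if pselect (i = j) is left ij then eq_rect i X v j ij else 0.

Lemma embed_fun_same i v : @embed_fun i v i = v.
Proof.
rewrite /embed_fun; case: pselect => // ij.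
by rewrite (Prop_irrelevance ij erefl).
Qed.

Lemma embed_fun_other i v j : i <> j -> @embed_fun i v j = 0.
Proof. by rewrite /embed_fun; case: pselect. Qed.

Fact embed_subproof i (v : X i) j :
  `|embed_fun v j| <= (`|v| *: abs_unit E i : abs_space E) j.
Proof.
rewrite abs_spaceE /= /indic; have [ij|ij] := pselect (i = j).
  by case: _ / ij; rewrite embed_fun_same mem_set// mulr1.
by rewrite embed_fun_other// normr0 mulr_ge0.
Qed.

Definition embed i (v : X i) : Z := AbsSum (abs_sum_solid (embed_subproof v)).1.

Lemma norm_embed_le i (v : X i) : `|embed v| <= `|v|.
Proof.
rewrite abs_sumE (le_trans (abs_sum_solid (embed_subproof v)).2)//.
by rewrite normrZ normr_id abs_eltE abs_norm1 mulr1.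
Qed.

Fact embed_linear i : linear (@embed i).
Proof.
move=> t u v; apply: abs_sum_inj => j; rewrite abs_sumD abs_sumZ /=.
have [ij|ij] := pselect (i = j).
  by case: _ / ij; rewrite !embed_fun_same.
by rewrite !embed_fun_other// scaler0 addr0.
Qed.

HB.instance Definition _ i :=
  GRing.isLinear.Build R (X i) (abs_sum E X) *:%R (@embed i) (@embed_linear i).

Section along.
Variables (w : forall i, X i) (w1 : forall i, `|w i| <= 1).

Fact along_subproof (a : abs_space E) :
  abs_set E (fun i => `|a i *: w i|) /\
  abs_norm E (fun i => `|a i *: w i|) <= `|a|.
Proof.
by apply: abs_solid => i; rewrite normr_id normrZ ler_piMr ?w1.
Qed.

Definition along a : Z := AbsSum (along_subproof a).1.

Lemma norm_along_le a : `|along a| <= `|a|.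
Proof. exact: (along_subproof a).2. Qed.

Fact along_linear : linear along.
Proof.
move=> t a b; apply: abs_sum_inj => i.
by rewrite abs_sumD abs_sumZ /= scalerDl scalerA.
Qed.

HB.instance Definition _ :=
  GRing.isLinear.Build R (abs_space E) (abs_sum E X) *:%R along along_linear.

Lemma along_unit i : along (abs_unit E i) = embed (w i).
Proof.
apply: abs_sum_inj => j /=; rewrite /indic.
have [ij|ij] := pselect (i = j).
  by case: _ / ij; rewrite embed_fun_same mem_set// scale1r.
by rewrite embed_fun_other// memNset ?scale0r// => /= ji; apply: ij; rewrite ji.
Qed.
End along.

Fact trunc_subproof (A : set I) (a : abs_space E) i :
  `|if `[< A i >] then a i else 0| <= `|a i|.
Proof. by case: ifP; rewrite // normr0. Qed.

Definition trunc A a : abs_space E := solid_elt (trunc_subproof A a).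

Fact sum_trunc_subproof (A : set I) (z : Z) i :
  `|if `[< A i >] then z i else 0| <= sum_norms z i.
Proof. by rewrite sum_normsE; case: ifP; rewrite // normr0. Qed.

Definition sum_trunc A (z : Z) : Z :=
  AbsSum (abs_sum_solid (sum_trunc_subproof A z)).1.

(** Induction on [s]: a new index adds one coordinate to both truncations, a
    repeated one adds nothing. *)
Lemma finite_domination (f : {linear Z -> R}) (l : {linear abs_space E -> R})
    (z : Z) (a : abs_space E) (s : seq I) :
  (forall i, f (embed (z i)) <= l (abs_unit E i) * a i) ->
  f (sum_trunc [set i | List.In i s] z) <= l (trunc [set i | List.In i s] a).
Proof.
move=> fl; elim: s => [|i s IHs].
  have -> : sum_trunc [set i | List.In i [::]] z = 0.
    by apply: abs_sum_inj => i /=; rewrite asboolF.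
  have -> : trunc [set i | List.In i [::]] a = 0.
    by apply: abs_elt_inj => i /=; rewrite asboolF.
  by rewrite !linear0.
have [si|si] := pselect (List.In i s).
  have -> : [set j | List.In j (i :: s)] = [set j | List.In j s].
    by apply/seteqP; split=> j /=; [case=> // <-|right].
  exact: IHs.
have -> : sum_trunc [set j | List.In j (i :: s)] z =
    embed (z i) + sum_trunc [set j | List.In j s] z.
  apply: abs_sum_inj => j; rewrite abs_sumD /=.
  have [ij|ij] := pselect (i = j).
    by case: _ / ij; rewrite embed_fun_same asboolT ?asboolF//= ?addr0//; left.
  rewrite embed_fun_other// add0r.
  by congr (if _ then _ else _); apply: asbool_equiv_eq; split=> [[]|]//; right.
have -> : trunc [set j | List.In j (i :: s)] a =
    a i *: (abs_unit E i : abs_space E) + trunc [set j | List.In j s] a.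
  apply: abs_elt_inj => j; rewrite !abs_spaceE /= /indic.
  have [ij|ij] := pselect (i = j).
    case: _ / ij; rewrite mem_set// mulr1 asboolT ?asboolF ?addr0//; last by left.
  rewrite memNset ?mulr0 ?add0r//; last by move=> /= ji; apply: ij; rewrite ji.
  by congr (if _ then _ else _); apply: asbool_equiv_eq; split=> [[]|]//; right.
by rewrite !linearD lerD// linearZ/= [leRHS]mulrC.
Qed.

Hypothesis span_dense :
  dense (linear_span (range (abs_unit E)) : set (abs_space E)).

(** The remainder [r] is [b - g] for an element [g] of the span of the unit vectors;
    as [r] and [b] agree outside a finite set, [r] dominates there every
    element that [b] dominates. *)
Lemma finite_trunc_approx (b : abs_space E) (e : R) : 0 < e ->
  exists s : seq I, exists2 r : abs_space E, `|r| <= e &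
    forall i, ~ List.In i s -> r i = b i.
Proof.
move=> e0.
have [||g [bg [n [c [w [wE gE]]]]]] := span_dense (O := ball b e).
- by exists b; exact: ballxx.
- exact: ball_open.
have /choice[k kE] : forall j, exists i, w j = abs_unit E i.
  by move=> j; have [i _ <-] := wE j; exists i.
exists [seq k j | j <- enum 'I_n]; exists (b - g).
  by move: bg; rewrite -ball_normE /= => /ltW.
move=> i si; rewrite !abs_spaceE; suff -> : g i = 0 by rewrite subr0.
have coord_sum (P : seq 'I_n) : (\sum_(j <- P) c j *: (w j : abs_space E)) i =
    \sum_(j <- P) c j * w j i.
  by elim: P => [|j P IH]; rewrite ?big_nil// !big_cons abs_spaceE IH.
rewrite gE coord_sum big1// => j _; rewrite kE /= /indic memNset ?mulr0//= => ji.
apply: si; rewrite ji; elim: (enum 'I_n) (mem_enum 'I_n j) => //= j' P IH.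
by rewrite inE => /orP[/eqP ->|/IH]; [left|right].
Qed.

(** A functional on the sum is determined by its coordinates: truncating [z] and
    [a] to a large enough finite set of indices changes [f z] and [l a]
    arbitrarily little, and on finitely supported elements the inequality
    follows by summation. *)
Lemma domination (f : {linear Z -> R}) (l : {linear abs_space E -> R}) (K : R)
    (z : Z) (a : abs_space E) :
  (forall z, f z <= `|z|) -> (forall a, l a <= K * `|a|) -> 0 <= K ->
  (forall i, f (embed (z i)) <= l (abs_unit E i) * a i) -> f z <= l a.
Proof.
move=> fle lle K0 fl; apply/ler_addgt0Pr => e e0.
have K1 : 0 < 1 + K by rewrite ltr_pwDl.
have eK : 0 < e / (1 + K) by rewrite divr_gt0.
have absa i : `| `|a i| | <= `|a i| by rewrite normr_id.
(* one element dominating both, so that a single finite set serves [a] and [z] *)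
pose b := solid_elt absa + sum_norms z.
have [s [r re rb]] := finite_trunc_approx b eK.
pose S := [set i | List.In i s].
have bi i : ~ S i -> `|r i| = `|a i| + `|z i|.
  by move=> Si; rewrite rb// !abs_spaceE /= ger0_norm ?addr_ge0.
have az : f (sum_trunc S z) <= l (trunc S a) by exact: finite_domination.
have ze : `|z - sum_trunc S z| <= `|r|.
  rewrite abs_sumE; apply: (abs_solid _).2 => i.
  rewrite normr_id abs_sumB /=; case: asboolP => Si.
    by rewrite subrr normr0.
  by rewrite bi// subr0 lerDr.
have ae : `|trunc S a - a| <= `|r|.
  apply: abs_space_norm_le => i; rewrite !abs_spaceE /=.
  case: asboolP => Si; first by rewrite subrr normr0.
  by rewrite bi// sub0r normrN lerDl.
have := fle (z - sum_trunc S z); have := lle (trunc S a - a).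
rewrite !linearB/=.
have := ler_wpM2l K0 ae.
have : (1 + K) * `|r| <= e by rewrite mulrC -ler_pdivlMr.
by lra.
Qed.

End absolute_sum.

(** * The estimate in the absolute sum *)

Section main_estimate.
Context {R : realType} {I : Type} (E : absBanachSpace R I)
  (X : I -> completeNormedModType R).
Local Notation Z := (abs_sum E X).
Implicit Types x y z : Z.

Lemma norm_sum_norms z : `|sum_norms z| = `|z|. Proof. by []. Qed.

(** With [a], [b], [c] the coordinate norms of [x], [y], [x + y] and [q = c / |c|]:
    the pointwise inequality [3 c <= 2 a + c + 2 b] gives
    [3 |c| <= |2 a + c| + 2], while [2 a + c] differs from [2 (a + q)] by a vector
    of norm [2 - |c|]. *)
Lemma sum_norms_descent x y : `|x| = 1 -> `|y| = 1 -> x + y != 0 ->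
  2 * `|x + y| - 2 <=
  `|sum_norms x + `|x + y|^-1 *: sum_norms (x + y)|.
Proof.
move=> x1 y1 xy0.
have n0 : 0 < `|x + y| by rewrite normr_gt0.
have n2 : `|x + y| <= 2 by rewrite (le_trans (ler_normD _ _))// x1 y1.
set c := sum_norms (x + y); set q := _ *: c.
have cq : c = `|x + y| *: q by rewrite /q scalerA mulfV ?gt_eqF// scale1r.
have q1 : `|q| = 1.
  by rewrite /q normrZ gtr0_norm ?invr_gt0// norm_sum_norms mulVf ?gt_eqF.
have upper : 3 * `|x + y| <= `|2 *: sum_norms x + c| + 2.
  have -> : 3 * `|x + y| = `|3 *: c| by rewrite normrZ ger0_norm.
  have y2 : `|2 *: sum_norms y| = 2.
    by rewrite normrZ norm_sum_norms y1 mulr1 ger0_norm.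
  rewrite -[X in _ <= _ + X]y2.
  rewrite (le_trans _ (ler_normD _ _))//; apply: abs_space_norm_le => i.
  rewrite !abs_spaceE !sum_normsE abs_sumD.
  have tri := ler_normD (x i) (y i).
  by apply: (le_trans _ (ler_norm _)); rewrite ger0_norm ?mulr_ge0//; lra.
have lower : `|2 *: sum_norms x + c| <=
    2 * `|sum_norms x + q| + (2 - `|x + y|).
  have -> : 2 *: sum_norms x + c =
      2 *: (sum_norms x + q) - (2 - `|x + y|) *: q.
    by rewrite scalerDr scalerBl -cq opprB -addrA (addrC (2 *: q)) subrK.
  rewrite (le_trans (ler_normB _ _))// (normrZ 2) (normrZ _ q) q1 mulr1.
  by rewrite !ger0_norm// subr_ge0.
by move: upper lower; clear; lra.
Qed.

(** This is [uniformly_smooth_norming] for the normalised family of the norms of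
    the [x i + y i]. Together with [l] being of norm at most [1], it says that the
    triangle inequality is almost an equality in the coordinates that matter
    to [l]. *)
Lemma uniformly_smooth_norm_sum (e : R) :
  uniformly_smooth (abs_space E) -> 0 < e ->
  exists2 h : R, 0 < h & forall (l : {linear abs_space E -> R}) x y,
    (forall a, l a <= `|a|) -> `|x| = 1 -> `|y| = 1 ->
    1 - h <= l (sum_norms x) -> 2 - h <= `|x + y| ->
    2 - e <= l (sum_norms (x + y)).
Proof.
move=> smooth e0.
have [k k0 kP] := uniformly_smooth_norming smooth (divr_gt0 e0 (ltr0n R 4)).
exists (Num.min (k / 2) (Num.min (e / 2) 1)).
  by rewrite !lt_min ltr01 !divr_gt0.
set h := Num.min _ _.
have [hk he h1] : [/\ h <= k / 2, h <= e / 2 & h <= 1].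
  by split; rewrite /h !ge_min lexx ?orbT.
move=> l x y lle x1 y1 lx xy.
have n0 : 0 < `|x + y| by move: h1 xy; clear; lra.
have n2 : `|x + y| <= 2 by rewrite (le_trans (ler_normD _ _))// x1 y1.
have xy0 : x + y != 0 by rewrite -normr_gt0.
have := sum_norms_descent x1 y1 xy0; set q := _ *: _ => xq.
have cq : sum_norms (x + y) = `|x + y| *: q.
  by rewrite /q scalerA mulfV ?gt_eqF// scale1r.
have lq : 1 - e / 4 <= l q.
  apply: (kP l (sum_norms x) q) => //.
  - by rewrite /q normrZ gtr0_norm ?invr_gt0// norm_sum_norms mulVf ?gt_eqF.
  - by move: hk k0 lx; clear; lra.
  - by move: hk xy xq; clear; lra.
rewrite cq linearZ/=.
have := ler_wpM2l (ltW n0) lq; rewrite mulrBr mulr1.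
have := ler_wpM2r (ltW (divr_gt0 e0 (ltr0n R 4))) n2.
by move: he xy; clear; rewrite -[_ *: l q]/(_ * l q); lra.
Qed.

Hypothesis span_dense :
  dense (linear_span (range (abs_unit E)) : set (abs_space E)).

Lemma almost_norming_along (f : {linear Z -> R}) (K : R) :
  (forall z, f z <= `|z|) -> 1 < K ->
  exists l : {linear abs_space E -> R}, [/\ forall a, l a <= `|a|,
    forall i, 0 <= l (abs_unit E i) &
    forall i (v : X i), f (embed E v) <= K * l (abs_unit E i) * `|v|].
Proof.
move=> fle K1.
have fe i (v : X i) : (f \o @embed _ _ E X i) v <= `|v|.
  by rewrite /= (le_trans (fle _))// norm_embed_le.
pose w i := cid2 (almost_norming_vector (fe i) K1).
have w1 i : `|s2val (w i)| <= 1 by case: (w i).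
have wK i (v : X i) : f (embed E v) <= K * f (embed E (s2val (w i))) * `|v|.
  by case: (w i) => u /= _; apply.
exists (f \o @along _ _ E X _ w1); split=> [a|i|i v]; rewrite /= ?along_unit//.
- by rewrite (le_trans (fle _))// norm_along_le.
- rewrite leNgt; apply/negP => fw.
  have := wK i (- s2val (w i)); rewrite linearN linearN normrN leNgt => /negP.
  apply.
  rewrite (@le_lt_trans _ _ 0) ?oppr_gt0//.
  by rewrite mulr_le0_ge0// mulr_ge0_le0// ltW// (lt_trans ltr01).
Qed.

(** In the following section [L] bounds the coordinates of [f], and [L (abs_unit E i)]
    stands for the norm of the functional that [f] induces on [X i]. *)
Section majorant.
Variables (f : {linear Z -> R}) (L : {linear abs_space E -> R}) (K : R).
Hypothesis fle : forall z, f z <= `|z|.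
Hypothesis Lle : forall a, L a <= K * `|a|.
Hypothesis K0 : 0 <= K.
Hypothesis L0 : forall i, 0 <= L (abs_unit E i).
Hypothesis fL : forall i (v : X i), f (embed E v) <= L (abs_unit E i) * `|v|.

Lemma majorant_ge0 (a : abs_space E) : (forall i, 0 <= a i) -> 0 <= L a.
Proof.
move=> a0; rewrite -(linear0 f); apply: (domination span_dense fle Lle K0) => i.
have -> : (0 : Z) i = 0 by [].
by rewrite !linear0; apply: mulr_ge0; [exact: L0|exact: a0].
Qed.

Lemma le_majorant x : f x <= L (sum_norms x).
Proof. by apply: (domination span_dense fle Lle K0) => i; exact: fL. Qed.

Variables (x y : Z) (d : R).

(** The right-hand side is the sum of two defects, that of the triangle inequality
    between [x i] and [y i] and that of [f] in norming [x i]. Outside this set the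
    defect hypothesis of [functional_ge_of_descent] holds. *)
Definition bad_coords : set I := [set i |
  d * (L (abs_unit E i) * Num.min `|x i| `|y i|) <=
  L (abs_unit E i) * (`|x i| + `|y i| - `|x i + y i|) +
  (L (abs_unit E i) * `|x i| - f (embed E (x i)))].

Fact bad_min_subproof i :
  `|if `[< bad_coords i >] then Num.min `|x i| `|y i| else 0| <= `|sum_norms x i|.
Proof.
case: ifP => _; last by rewrite normr0.
by rewrite ger0_norm ?le_min ?normr_ge0// sum_normsE normr_id ge_min lexx.
Qed.

Definition bad_min : abs_space E := solid_elt bad_min_subproof.

Lemma bad_minE i :
  bad_min i = if `[< bad_coords i >] then Num.min `|x i| `|y i| else 0.
Proof. by []. Qed.

Lemma bad_min_ge0 i : 0 <= bad_min i.
Proof. by rewrite bad_minE; case: ifP => // _; rewrite le_min !normr_ge0. Qed.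

(** On the bad coordinates [d] times the minimum is at most the sum of the two
    defects, and elsewhere these are nonnegative; the right-hand side is the
    total of all defects. *)
Lemma bad_min_le : d * L bad_min <=
  L (sum_norms x) + L (sum_norms y) - L (sum_norms (x + y)) +
  (L (sum_norms x) - f x).
Proof.
pose gap : abs_space E := sum_norms x + sum_norms y - sum_norms (x + y).
have : f x <= L (gap + sum_norms x - d *: bad_min).
  apply: (domination span_dense fle Lle K0) => i.
  rewrite !abs_spaceE bad_minE !sum_normsE abs_sumD.
  case: asboolP => [Ai|_].
    rewrite mulrBr mulrDr (mulrCA _ d).
    by move: Ai; rewrite /bad_coords /=; lra.
  rewrite mulr0 subr0 mulrDr -[leLHS]add0r lerD//.
  by rewrite mulr_ge0// subr_ge0 ler_normD.
rewrite linearB linearD linearZ/= /gap linearB linearD -[d *: _]/(d * L bad_min).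
by lra.
Qed.

(** The bad coordinates at which smallness of [bad_min] says nothing on [y]. *)
Definition flip_coords : set I := [set i | bad_coords i /\ `|x i| <= `|y i|].

(** Flipping changes a coordinate by [2 * |x i|], which is twice [bad_min] there. *)
Lemma flip_coords_le :
  L (sum_norms x) - 2 * L bad_min <= L (flip flip_coords (sum_norms x)).
Proof.
have : 0 <= L (flip flip_coords (sum_norms x) - sum_norms x + 2 *: bad_min).
  apply: majorant_ge0 => i; rewrite !abs_spaceE bad_minE /=.
  case: asboolP => [[Ai xy]|_].
    by rewrite asboolT// (min_idPl xy); lra.
  by rewrite subrr add0r mulr_ge0// -bad_minE bad_min_ge0.
rewrite linearD linearB linearZ/= -[2 *: _]/(2 * L bad_min).
by lra.
Qed.

(** Coordinatewise, [f (y i)] is at least [(1 - 2 e)] times the bound [L e_i * |y i|]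
    on good coordinates, and at least minus that bound on bad ones; flipping
    accounts for the latter where [|x i| <= |y i|], and [2 * bad_min] does where
    [|y i| < |x i|]. *)
Lemma functional_ge_of_flip (t e : R) :
  (forall i (u v : X i), `|u| = 1 -> `|v| = 1 ->
    2 - t <= `|u + v| -> `|u - t *: v| <= 1 - t * (1 - e)) ->
  0 < t -> 0 <= e <= 1 -> d = e * t ->
  L (flip flip_coords (sum_norms y)) - 2 * e * L (sum_norms y) - 2 * L bad_min
    <= f y.
Proof.
move=> descent t0 e01 dE.
have e0 : 0 <= e by case/andP: e01.
have : f (- y) <= L (- flip flip_coords (sum_norms y) + (2 * e) *: sum_norms y +
    2 *: bad_min).
  apply: (domination span_dense fle Lle K0) => i.
  rewrite !abs_spaceE bad_minE abs_sumN !linearN /=.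
  have lam0 := L0 i.
  have fy : - f (embed E (y i)) <= L (abs_unit E i) * `|y i|.
    by have := fL (- y i); rewrite !linearN normrN.
  have ey : 0 <= L (abs_unit E i) * (2 * e * `|y i|) by rewrite !mulr_ge0.
  have lmin0 : 0 <= L (abs_unit E i) * Num.min `|x i| `|y i|.
    by rewrite mulr_ge0// le_min !normr_ge0.
  have [Ai|nA] := pselect (bad_coords i); last first.
    rewrite asboolF => [|[]//]; rewrite asboolF// mulr0 addr0.
    have : (1 - 2 * e) * (L (abs_unit E i) * `|y i|) <= f (embed E (y i)).
      apply: (functional_ge_of_descent (g := f \o @embed _ _ E X i) (t := t)
        (u := x i)) => //.
      + exact: descent.
      + exact: fL.
      + by move: nA; rewrite /bad_coords /= dE => /negP; rewrite -ltNge.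
    by lra.
  rewrite (asboolT Ai); have [xy|xy] := leP `|x i| `|y i|.
    by rewrite asboolT//; move: fy ey lmin0; rewrite (min_idPl xy); lra.
  rewrite asboolF => [|[_]]; last by rewrite leNgt xy.
  by move: fy ey; lra.
have -> : f (- y) = - f y by rewrite linearN.
rewrite 2!linearD linearN 2!linearZ/=.
rewrite -[2 *: _]/(2 * L bad_min) -[(2 * e) *: _]/(2 * e * L (sum_norms y)).
by lra.
Qed.

End majorant.

(** The choice of constants. The tolerance [d = e t] of the bad coordinates is the
    one for which [functional_ge_of_descent] applies; [k] is the tolerance of
    smoothness for the flipped functional, and [s] is so small against [d] that
    [2 L m <= k / 2], where [m] is the minimum on bad coordinates. *)
Lemma uacs_estimate (e t : R) : 0 < e <= 1 -> 0 < t ->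
  (forall i (u v : X i), `|u| = 1 -> `|v| = 1 ->
    2 - t <= `|u + v| -> `|u - t *: v| <= 1 - t * (1 - e)) ->
  uniformly_smooth (abs_space E) ->
  exists2 h : R, 0 < h & forall (f : {linear Z -> R}) x y,
    (forall z, f z <= `|z|) -> `|x| = 1 -> `|y| = 1 ->
    2 - h <= `|x + y| -> 1 - h <= f x -> 1 - 6 * e <= f y.
Proof.
move=> /andP[e0 e1] t0 descent smooth.
have [k k0 kP] := uniformly_smooth_norming smooth e0.
pose d := e * t; have d0 : 0 < d by exact: mulr_gt0.
have [s s0 [sk se]] : exists2 s, 0 < s & 16 * s <= d * k /\ 16 * s <= d * e.
  exists (Num.min k e * d / 16).
    by rewrite divr_gt0// mulr_gt0// lt_min k0.
  rewrite mulrC divfK ?pnatr_eq0// mulrC.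
  by split; rewrite ler_pM2l// ge_min lexx ?orbT.
have [j j0 jP] := uniformly_smooth_norm_sum smooth s0.
pose h := Num.min (Num.min (j / 2) (k / 4)) (Num.min (s / 4) 1).
have h0 : 0 < h by rewrite !lt_min ltr01 !divr_gt0.
have [hj hk hs h1] : [/\ h <= j / 2, h <= k / 4, h <= s / 4 & h <= 1].
  by split; rewrite /h !ge_min lexx ?orbT.
exists h => // f x y fle x1 y1 xy fx.
pose K : R := 1 + h.
have K1 : 1 < K by rewrite ltrDl.
have K2 : K <= 2 by move: h1; rewrite /K; clear; lra.
have Kgt0 : 0 < K := lt_trans ltr01 K1.
have K0 := ltW Kgt0.
have [l [lle l0 fl]] := almost_norming_along fle K1.
have [L LE] : exists L : {linear abs_space E -> R}, forall p, L p = K * l p.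
  by exists (K \*: l).
have Lle p : L p <= K * `|p| by rewrite LE ler_wpM2l.
have L0 i : 0 <= L (abs_unit E i) by rewrite LE mulr_ge0.
have fL i (v : X i) : f (embed E v) <= L (abs_unit E i) * `|v| by rewrite LE.
have la1 : l (sum_norms x) <= 1 by rewrite -x1.
have lb1 : l (sum_norms y) <= 1 by rewrite -y1.
have la : 1 - 2 * h <= l (sum_norms x).
  have := le_trans fx (le_majorant fle Lle K0 fL x).
  have := ler_wpM2l (ltW h0) la1.
  by rewrite LE /K mulrDl mul1r; clear; lra.
have lc : 2 - s <= l (sum_norms (x + y)).
  apply: jP => //; first by move: la hj; clear; lra.
  by move: xy hj j0; clear; lra.
pose m := bad_min f L x y d.
have m0 : 0 <= L m.
  by apply: (majorant_ge0 fle Lle K0 L0) => i; exact: bad_min_ge0.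
(* the triangle defects contribute [K * s <= 2 s], the norming defect [2 h] *)
have dm : d * L m <= 4 * s.
  have := bad_min_le fle Lle K0 L0 fL x y d; rewrite -/m.
  have : L (sum_norms x) + L (sum_norms y) - L (sum_norms (x + y)) <= K * s.
    rewrite !LE -mulrDr -mulrBr ler_pM2l//.
    by move: la1 lb1 lc; clear; lra.
  have : L (sum_norms x) <= K by rewrite LE ler_piMr.
  have := ler_wpM2r (ltW s0) K2.
  by move: fx hs s0; rewrite /K; clear; lra.
have [mk me] : 2 * L m <= k / 2 /\ 2 * L m <= e.
  by split; rewrite -(ler_pM2l d0); move: dm sk se s0; clear; lra.
pose A := flip_coords f L x y d.
have flipa : 1 - k <= l (flip A (sum_norms x)).
  have lm : 2 * L m <= K * (2 * L m) by rewrite ler_peMl ?mulr_ge0// ltW.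
  have := flip_coords_le fle Lle K0 L0 x y d; rewrite -/m -/A !LE.
  rewrite -[K * l m]LE => drop.
  rewrite -(ler_pM2l Kgt0); apply: le_trans drop.
  apply: le_trans (_ : K * (l (sum_norms x) - 2 * L m) <= _).
    by rewrite ler_pM2l//; move: la hk mk; clear; lra.
  by rewrite mulrBr lerD2l lerN2.
(* smoothness for the functional [l] with the signs on [A] changed *)
have flipb : 1 - e <= l (flip A (sum_norms y)).
  apply: (kP (l \o flip A) (sum_norms x) (sum_norms y)) => //=.
  - by move=> v; rewrite (le_trans (lle _))// norm_flip_le.
  - apply: (@le_trans _ _ `|x + y|); first by move: xy hk k0; clear; lra.
    rewrite -(norm_sum_norms (x + y)); apply: abs_space_norm_le => i.
    rewrite abs_spaceE !sum_normsE abs_sumD.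
    by rewrite normr_id (le_trans (ler_normD _ _))// ler_norm.
have e01 : 0 <= e <= 1 by rewrite ltW.
apply: le_trans (functional_ge_of_flip fle Lle K0 L0 fL x y descent t0 e01 erefl).
rewrite -/d -/m -/A.
have Lb : L (sum_norms y) <= 2.
  by rewrite LE (le_trans _ K2)// ler_piMr.
have Lflip : 1 - e <= L (flip A (sum_norms y)).
  rewrite LE (le_trans flipb)// ler_peMl//; last exact: ltW.
  by rewrite (le_trans _ flipb)// subr_ge0.
have := ler_wpM2l (ltW e0) Lb.
by move: me Lflip; clear; lra.
Qed.
End main_estimate.

Theorem corollary3p18 (R : realType) (I : Type) (E : absBanachSpace R I)
    (X : I -> completeNormedModType R) :
  [set: I] !=set0 ->
  dense (linear_span (range (abs_unit E)) : set (abs_space E)) ->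
  (forall eps : R, 0 < eps <= 2 ->
     (0 < ereal_inf [set delta_uacs (X i) eps | i in [set: I]])%E) ->
  uniformly_smooth (abs_space E) ->
  uacs (abs_sum E X).
Proof.
move=> _ span_dense delta_pos smooth x y f x1 y1 f1 xy fx.
apply/cvgrPdist_le => r r0.
pose e : R := Num.min r 1 / 6.
have [e01 er] : 0 < e <= 1 /\ 6 * e <= r.
  rewrite /e [6 * _]mulrC divfK ?pnatr_eq0// ge_min lexx; split=> //.
  rewrite divr_gt0 ?lt_min ?r0//= ler_pdivrMr// ge_min.
  by apply/orP; right; rewrite mul1r ler1n.
have e02 : 0 < e <= 2.
  by case/andP: e01 => -> /le_trans; apply; rewrite ler1n.
have [t t0 descent] := uacs_uniform_descent e01 (delta_pos e e02).
have [h h0 est] := uacs_estimate span_dense e01 t0 descent smooth.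
move/cvgrPdist_le : xy => /(_ h h0) xy; move/cvgrPdist_le : fx => /(_ h h0) fx.
near=> n.
have fle z : f n z <= `|z| by exact: dual_sphere_le (f1 n).
have y1n : `|y n| = 1 := y1 n.
have fy1 : f n (y n) <= 1 by rewrite -y1n.
have fy : 1 - 6 * e <= f n (y n).
  apply: (est (f n) (x n) (y n) fle (x1 n) y1n).
    have /ler_normlP[_] : `|2 - `|x n + y n| | <= h by near: n.
    by rewrite lerBlDl -lerBlDr.
  have /ler_normlP[_] : `|1 - f n (x n)| <= h by near: n.
  by rewrite lerBlDl -lerBlDr.
by rewrite ger0_norm ?subr_ge0// lerBlDl -lerBlDr (le_trans _ fy)// lerD2l lerN2.
Unshelve. all: by end_near. Qed.
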